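(* Let $\mathbb{F}$ be a field and let $(T,\leq)$ be a dense totally ordered set such that every interval in $T$ has a countable coinitial subset. Let $M$ be a persistence module over $\mathbb{F}$ indexed by $T$ that is q-tame and upper semi-continuous. Then there exists a collection of intervals $(I_{\alpha})_{\alpha\in A}$ in $T$ such that $$M\cong\prod_{\alpha\in A}C(I_{\alpha}),$$ and this collection is unique up to reordering: if $(J_{\beta})_{\beta\in B}$ is another collection of intervals in $T$ with $M\cong\prod_{\beta\in B}C(J_{\beta})$, then there is a bijection $\sigma\colon A\to B$ with $I_{\alpha}=J_{\sigma(\alpha)}$ for all $\alpha\in A$.
   Context: A totally ordered set $T$ is regarded as a category with a unique morphism $s\to t$ whenever $s\leq t$. A persistence module indexed by $T$ is a functor $M$ from $T$ to the category of $\mathbb{F}$-vector spaces, with values $M_t$ and structure maps $M_{s,t}\colon M_s\to M_t$ for $s\leq t$. Morphisms are natural transformations; kernels, cokernels, direct sums and products are computed pointwise. $M$ is q-tame if $M_{s,t}$ has finite rank for all $s<t$ in $T$. $M$ is upper semi-continuous if the canonical map $M_t\to\lim_{s>t}M_s$ is an isomorphism for all $t\in T$ (limits over empty index sets are $0$). An interval in $T$ is a non-empty subset $I\subseteq T$ such that $s\leq u\leq t$ with $s,t\in I$ and $u\in T$ implies $u\in I$. The interval module $C(I)$ has $C(I)_t=\mathbb{F}$ if $t\in I$ and $C(I)_t=0$ otherwise, with structure map $C(I)_{s,t}=\mathrm{id}_{\mathbb{F}}$ if $s,t\in I$ and $0$ otherwise. $T$ is dense if for all $s<t$ in $T$ there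 is $u\in T$ with $s<u<t$. For $N\subseteq I\subseteq T$, the subset $N$ is coinitial in $I$ if for all $t\in I$ there is $s\in N$ with $s\leq t$. *)

(* Defs.v *)
From HB Require Import structures.
From mathcomp Require Import all_boot all_order all_algebra.
From mathcomp Require Import boolp classical_sets functions cardinality.

Set Implicit Arguments.
Unset Strict Implicit.
Unset Printing Implicit Defensive.

Import Order.TTheory GRing.Theory.
Local Open Scope classical_set_scope.
Local Open Scope ring_scope.

(* Product of an arbitrary family of vector spaces, with pointwise operations;
   [functions] only has the non-dependent case. *)
Definition lmod_prod (R : pzRingType) (A : Type) (V : A -> lmodType R) : Type :=
  forall a, V a.

Section LmodProd.
Context (R : pzRingType) (A : Type) (V : A -> lmodType R).
Implicit Types f g h : lmod_prod V.

HB.instance Definition _ := gen_eqMixin (lmod_prod V).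
HB.instance Definition _ := gen_choiceMixin (lmod_prod V).

Let addp f g : lmod_prod V := fun a => f a + g a.
Let oppp f : lmod_prod V := fun a => - f a.
Let scalep (k : R) f : lmod_prod V := fun a => k *: f a.

Let addpA : associative addp.
Proof. by move=> f g h; apply: functional_extensionality_dep => a; exact: addrA. Qed.
Let addpC : commutative addp.
Proof. by move=> f g; apply: functional_extensionality_dep => a; exact: addrC. Qed.
Let add0p : left_id (fun a => 0) addp.
Proof. by move=> f; apply: functional_extensionality_dep => a; exact: add0r. Qed.
Let addNp : left_inverse (fun a => 0) oppp addp.
Proof. by move=> f; apply: functional_extensionality_dep => a; exact: addNr. Qed.

HB.instance Definition _ :=
  GRing.isZmodule.Build (lmod_prod V) addpA addpC add0p addNp.

Let scalepA k l f : scalep k (scalep l f) = scalep (k * l) f.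
Proof. by apply: functional_extensionality_dep => a; exact: scalerA. Qed.
Let scale1p : left_id 1 scalep.
Proof. by move=> f; apply: functional_extensionality_dep => a; exact: scale1r. Qed.
Let scalepDr : right_distributive scalep +%R.
Proof. by move=> k f g; apply: functional_extensionality_dep => a; exact: scalerDr. Qed.
Let scalepDl f : {morph scalep^~ f : k l / k + l}.
Proof. by move=> k l; apply: functional_extensionality_dep => a; exact: scalerDl. Qed.

HB.instance Definition _ :=
  GRing.Zmodule_isLmodule.Build R (lmod_prod V) scalepA scale1p scalepDr scalepDl.

End LmodProd.

Section Order.
Context (d : Order.disp_t) (T : orderType d).

Definition order_dense : Prop :=
  forall s t : T, (s < t)%O -> exists u : T, (s < u < t)%O.

Record order_interval := OrderInterval {
  interval_set :> set T;
  interval_nonempty : interval_set !=set0;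
  interval_convex : forall s u t : T,
    interval_set s -> interval_set t -> (s <= u <= t)%O -> interval_set u
}.

Definition coinitial (N I : set T) : Prop :=
  N `<=` I /\ forall t, I t -> exists2 s, N s & (s <= t)%O.

End Order.
Arguments order_dense {d} T.

Record persmod (F : fieldType) (d : Order.disp_t) (T : orderType d) := PersMod {
  pm_obj :> T -> lmodType F;
  pm_map : forall s t : T, (s <= t)%O -> {linear pm_obj s -> pm_obj t};
  pm_map_id : forall (t : T) (tt : (t <= t)%O) (x : pm_obj t), pm_map tt x = x;
  pm_map_comp : forall (s t u : T) (st : (s <= t)%O) (tu : (t <= u)%O)
    (su : (s <= u)%O) (x : pm_obj s), pm_map tu (pm_map st x) = pm_map su x
}.

Section Persmod.
Context (F : fieldType) (d : Order.disp_t) (T : orderType d).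
Implicit Types M N : persmod F T.

Record persmod_hom M N := PersModHom {
  pm_hom :> forall t : T, {linear M t -> N t};
  pm_hom_nat : forall (s t : T) (st : (s <= t)%O) (x : M s),
    pm_hom t (pm_map M st x) = pm_map N st (pm_hom s x)
}.

Definition persmod_iso M N : Prop :=
  exists (f : persmod_hom M N) (g : persmod_hom N M),
    forall t : T, cancel (f t) (g t) /\ cancel (g t) (f t).

Section Product.
Context (A : Type) (N : A -> persmod F T).

Definition prod_obj (t : T) : lmodType F := lmod_prod (fun a => N a t).

Section Map.
Context (s t : T) (st : (s <= t)%O).

Definition prod_map (x : prod_obj s) : prod_obj t := fun a => pm_map (N a) st (x a).

Let prod_map_linear : linear prod_map.
Proof. by move=> k x y; apply: functional_extensionality_dep => a; exact: linearP. Qed.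

HB.instance Definition _ :=
  GRing.isLinear.Build F (prod_obj s) (prod_obj t) *:%R prod_map prod_map_linear.
End Map.

Lemma prod_map_id (t : T) (tt : (t <= t)%O) (x : prod_obj t) : prod_map tt x = x.
Proof. by apply: functional_extensionality_dep => a; exact: pm_map_id. Qed.

Lemma prod_map_comp (s t u : T) (st : (s <= t)%O) (tu : (t <= u)%O)
  (su : (s <= u)%O) (x : prod_obj s) : prod_map tu (prod_map st x) = prod_map su x.
Proof. by apply: functional_extensionality_dep => a; exact: pm_map_comp. Qed.

Definition persmod_prod : persmod F T :=
  @PersMod F d T prod_obj (fun s t st => prod_map st) prod_map_id prod_map_comp.

End Product.

Section IntervalModule.

(* [b] stands for membership of the index in the interval. *)
Definition cell (b : bool) : lmodType F := if b then (F^o : lmodType F) else ('rV[F]_0 : lmodType F).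

Definition cell_map (b c : bool) : {linear cell b -> cell c} :=
  match b, c return {linear cell b -> cell c} with
  | true, true => idfun
  | _, _ => \0
  end.

Context (I : order_interval T).

Lemma cell_map_id (t : T) (tt : (t <= t)%O) (x : cell (t \in (I : set T))) :
  cell_map _ (t \in (I : set T)) x = x.
Proof. by move: x; case: (_ \in _) => //= x; apply/rowP => -[]. Qed.

Lemma cell_map_comp (s t u : T) (st : (s <= t)%O) (tu : (t <= u)%O)
    (su : (s <= u)%O) (x : cell (s \in (I : set T))) :
  cell_map (t \in (I : set T)) (u \in (I : set T)) (cell_map _ _ x) =
  cell_map _ _ x.
Proof.
have : s \in (I : set T) -> u \in (I : set T) -> t \in (I : set T).
  rewrite !inE => Is Iu; apply: interval_convex Is Iu _.
  by rewrite st tu.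
move: x; case: (s \in _); case: (t \in _); case: (u \in _) => //= x Ix;
  rewrite ?linear0 //.
by have := Ix isT isT.
Qed.

Definition interval_module : persmod F T :=
  @PersMod F d T (fun t => cell (t \in (I : set T)))
    (fun s t _ => cell_map (s \in (I : set T)) (t \in (I : set T)))
    cell_map_id cell_map_comp.

End IntervalModule.

Definition finite_rank (U V : lmodType F) (f : {linear U -> V}) : Prop :=
  exists (n : nat) (u : 'I_n -> U), forall x : U,
    exists c : 'I_n -> F, f x = \sum_(i < n) c i *: f (u i).

Definition q_tame M : Prop :=
  forall (s t : T) (st : (s < t)%O), finite_rank (pm_map M (ltW st)).

Section Limit.
Context (M : persmod F T) (t : T).

Definition family_above : lmodType F :=
  lmod_prod (fun s : {s : T | (t < s)%O} => M (sval s)).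

Definition compatible : {pred family_above} := fun x =>
  `[< forall (r s : {s : T | (t < s)%O}) (rs : (sval r <= sval s)%O),
        pm_map M rs (x r) = x s >].

Lemma compatible_submod_closed : submod_closed compatible.
Proof.
split.
  by apply/asboolP => r s rs; rewrite linear0.
move=> k x y /asboolP xc /asboolP yc; apply/asboolP => r s rs.
by rewrite linearP xc yc.
Qed.

HB.instance Definition _ :=
  GRing.isSubmodClosed.Build F family_above compatible compatible_submod_closed.

Record lim_above := LimAbove {
  lim_family : family_above;
  lim_compatible : lim_family \in compatible
}.

HB.instance Definition _ := [isSub for lim_family].
HB.instance Definition _ := [Choice of lim_above by <:].
HB.instance Definition _ := [SubChoice_isSubLmodule of lim_above by <:].

Definition restrict_above (x : M t) : family_above :=
  fun s => pm_map M (ltW (svalP s)) x.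

Lemma restrict_above_compatible (x : M t) : restrict_above x \in compatible.
Proof. by apply/asboolP => r s rs; exact: pm_map_comp. Qed.

Definition to_lim (x : M t) : lim_above := LimAbove (restrict_above_compatible x).

Let to_lim_linear : linear to_lim.
Proof.
move=> k x y; apply: val_inj; rewrite linearP /=.
by apply: functional_extensionality_dep => s; exact: linearP.
Qed.

HB.instance Definition _ :=
  GRing.isLinear.Build F (M t) lim_above *:%R to_lim to_lim_linear.

End Limit.

(* [to_lim M t] is linear, so bijectivity makes it an isomorphism. *)
Definition upper_semicontinuous M : Prop := forall t : T, bijective (to_lim (M := M) (t := t)).

End Persmod.
Arguments interval_module F {d T} I.

(* Main.v *)
Require Import Defs.
From HB Require Import structures.
From mathcomp Require Import all_boot all_order all_algebra.
From mathcomp Require Import boolp classical_sets functions cardinality.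

(** Existence. For every down-closed set [D] of indices without a maximum, look
    at the colimit [E] of [M] over [D], with its chain of subspaces, the images
    of the [M t] for [t] in [D]. Zorn's lemma gives a family of vectors [e] of
    [E] that die at every index beyond [D], with biorthogonal functionals [phi]
    such that [phi] kills every image that misses [e], and such that no nonzero
    vector dying beyond [D] is killed by all the [phi] ([separating_system],
    [separating_systems]). Each pair [(D, (e, phi))] gives the interval of those
    [t] in [D] whose image contains [e], and [phi], restricted along
    [M t -> E], is a morphism from [M] to the module of this interval. Working
    with functionals on the colimit makes the compatibility along the interval
    automatic, where a choice of compatible vectors would call for an inverse
    limit argument.

    Together these morphisms are an isomorphism onto the product. They separate
    points, because a nonzero [x] in [M t] survives exactly up to some such [D],
    by upper semi-continuity, and is then detected over [D]
    ([bar_coord_separated]). Finitely many coordinates can be prescribed,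
    because the vectors with upper end [D] are invisible to larger upper ends,
    so the system is triangular ([bar_coord_solvable]). By finite rank, only
    finitely many intervals contain both [t] and a given [s > t]; so prescribed
    coordinates determine an element of the image of [M t] in [M s] for each
    [s > t], and upper semi-continuity glues these ([bar_coord_onto]).

    Uniqueness. The number of intervals containing both [p] and [q], for
    [p < q], is the rank of [M p -> M q], hence finite and independent of the
    decomposition. None of the intervals has a maximum, so each contains some
    [s < t]; and the finite multiset of the intervals through [s] and [t] can be
    read off from these ranks, by peeling off inclusion-maximal intervals
    ([perm_eq_through]). *)

Set Implicit Arguments.
Unset Strict Implicit.
Unset Printing Implicit Defensive.

Import Order.TTheory GRing.Theory.
Local Open Scope classical_set_scope.
Local Open Scope ring_scope.

(** * Linear algebra *)

Section AsLinear.
Context (F : fieldType) (U V : lmodType F) (f : U -> V) (lf : linear f).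

(** The linearity proof is an argument so that the linear structure of [as_linear lf]
    can be found from the term. *)
Definition as_linear of linear f := f.

HB.instance Definition _ := GRing.isLinear.Build F U V *:%R (as_linear lf) lf.

Definition linear_of : {linear U -> V} := as_linear lf.

End AsLinear.

Section LinearAlgebra.
Context (F : fieldType).
Implicit Types (U V : lmodType F).

Definition subspace V (X : set V) :=
  X 0 /\ forall (k : F) (x y : V), X x -> X y -> X (k *: x + y).

Section Subspace.
Context (V : lmodType F) (X : set V) (sX : subspace X).

Lemma subspaceD x y : X x -> X y -> X (x + y).
Proof. by move=> Xx Xy; rewrite -[x]scale1r; apply: sX.2. Qed.

Lemma subspaceZ k x : X x -> X (k *: x).
Proof. by move=> Xx; rewrite -[_ *: _]addr0; apply: sX.2 => //; exact: sX.1. Qed.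

Lemma subspaceB x y : X x -> X y -> X (x - y).
Proof. by move=> Xx Xy; rewrite addrC -scaleN1r; apply: sX.2. Qed.

Lemma subspace_sum (A : Type) (l : seq A) (P : pred A) (G : A -> V) :
  (forall a, P a -> X (G a)) -> X (\sum_(a <- l | P a) G a).
Proof.
move=> XG; elim/big_rec: _ => [|a x Pa Xx]; first exact: sX.1.
exact: subspaceD (XG _ Pa) Xx.
Qed.

End Subspace.

Lemma subspace_bigcup_chain V (C : set (set V)) :
  C !=set0 -> (forall X, C X -> subspace X) -> total_on C subset ->
  subspace (\bigcup_(X in C) X).
Proof.
move=> [X0 CX0] sC tC; split; first by exists X0 => //; exact: (sC _ CX0).1.
move=> k x y [X CX Xx] [Y CY Yy].
case: (tC _ _ CX CY) => XY; [exists Y|exists X] => //.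
  by apply: (sC _ CY).2 => //; exact: XY.
by apply: (sC _ CX).2 => //; exact: XY.
Qed.

(** A subspace that is maximal among those containing [W] but not [v] is a
    hyperplane complementary to the line of [v], so the coefficient along [v] is
    a linear functional. *)
Lemma separating_functional V (W : set V) (v : V) :
  subspace W -> ~ W v ->
  exists f : {linear V -> F^o}, (forall w, W w -> f w = 0) /\ f v = 1.
Proof.
move=> sW nWv.
pose P (X : set V) := subspace (W `|` X) /\ ~ (W `|` X) v.
have [C CP tC|X [[sX nXv] maxX]] := @Zorn_bigcup V P.
  (* Zorn runs over the sets X for which W together with X is a subspace, so
     that the empty chain is bounded as well, by W itself. *)
  have [->|/set0P[X0 CX0]] := eqVneq C set0.
    by rewrite /P bigcup_set0 setU0.
  rewrite /P; have -> : W `|` \bigcup_(X in C) X =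
      \bigcup_(Y in [set W `|` X | X in C]) Y.
    apply/seteqP; split=> [x [Wx|[X CX Xx]]|x [_ [X CX <-]] [Wx|Xx]].
    - by exists (W `|` X0); [exists X0|left].
    - by exists (W `|` X); [exists X|right].
    - by left.
    - by right; exists X.
  split; last by move=> [_ [X CX <-]]; exact: (CP _ CX).2.
  apply: subspace_bigcup_chain; first by exists (W `|` X0), X0.
    by move=> _ [X CX <-]; exact: (CP _ CX).1.
  move=> _ _ [X CX <-] [Y CY <-].
  by case: (tC _ _ CX CY) => XY; [left|right]; apply: setUS.
set H := W `|` X in sX nXv.
have decH x : exists c : F, H (x - c *: v).
  have [Hx|nHx] := pselect (H x); first by exists 0; rewrite scale0r subr0.
  pose H' := [set y | exists c : F, H (y - c *: x)].
  have HH' y : H y -> H' y by move=> Hy; exists 0; rewrite scale0r subr0.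
  have sH' : subspace H'.
    split; first exact/HH'/sX.1.
    move=> k y z [c Hy] [c' Hz]; exists (k * c + c').
    have -> : k *: y + z - (k * c + c') *: x = k *: (y - c *: x) + (z - c' *: x).
      by rewrite scalerDl scalerBr scalerA opprD addrACA.
    exact: sX.2.
  have WH' : W `|` H' = H' by apply: setUidr => w Ww; apply: HH'; left.
  (* H' is the span of H and x. It is larger than H, so by maximality it
     contains v, and the coefficient of x in v cannot vanish. *)
  have [c Hc] : H' v.
    apply: contrapT => nH'v; apply: (maxX H'); last by rewrite /P WH'.
    split; first by move=> y Xy; apply: HH'; right.
    move=> /(_ x) XH'; apply: nHx; right; apply: XH'; exists 1.
    by rewrite scale1r subrr; exact: sX.1.
  have c0 : c != 0 by apply/eqP => c0; apply: nXv; rewrite c0 scale0r subr0 in Hc.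
  exists c^-1.
  have -> : x - c^-1 *: v = (- c^-1) *: (v - c *: x).
    by rewrite scalerBr scalerA mulNr mulVf// scaleN1r opprK scaleNr addrC.
  exact: subspaceZ.
have uniqH x c c' : H (x - c *: v) -> H (x - c' *: v) -> c = c'.
  move=> Hc Hc'; apply/eqP; rewrite -subr_eq0; apply: contrapT => /negP cc'.
  apply: nXv; have -> : v = (c - c')^-1 *: ((x - c' *: v) - (x - c *: v)).
    rewrite opprB [X in _ *: X]addrC addrA subrK -scalerBl.
    by rewrite scalerA mulVf// scale1r.
  by apply: subspaceZ => //; exact: subspaceB.
have [f Hf] := choice decH.
have lf : linear (f : V -> F^o).
  move=> k x y; apply: (uniqH (k *: x + y)) => //.
  suff : H (k *: x + y - (k * f x + f y) *: v) by [].
  have -> : k *: x + y - (k * f x + f y) *: v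
            = k *: (x - f x *: v) + (y - f y *: v).
    by rewrite scalerDl scalerBr -scalerA opprD addrACA.
  exact: sX.2.
exists (linear_of lf); split=> [w Ww|]; last first.
  by apply: (uniqH v) => //; rewrite scale1r subrr; exact: sX.1.
by apply: (uniqH w) => //; rewrite scale0r subr0; left.
Qed.

Lemma uniq_sum_widen V (A : eqType) (l l' : seq A) (G : A -> V) :
  uniq l -> uniq l' -> {subset l <= l'} ->
  (forall a, a \in l' -> a \notin l -> G a = 0) ->
  \sum_(a <- l') G a = \sum_(a <- l) G a.
Proof.
move=> ul ul' ll' G0; rewrite (bigID (mem l))/= [X in _ + X]big1_seq ?addr0; last first.
  by move=> a /andP[al al']; exact: G0.
rewrite -big_filter; apply: perm_big; apply: uniq_perm; rewrite ?filter_uniq//.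
by move=> a; rewrite mem_filter; case: (boolP (a \in l)) => //= /ll'.
Qed.

Section Biorthogonal.
Context (V : lmodType F) (B : set (V * (V -> F^o))).
Hypothesis linB : forall p, B p -> linear p.2.
Hypothesis dualB : forall p q, B p -> B q -> p.2 q.1 = (p == q)%:R.

(** The span of the vectors of [B], through the expansion that biorthogonality
    forces. *)
Definition expansions : set V := [set u | exists l : seq (V * (V -> F^o)),
  [/\ uniq l, forall p, p \in l -> B p & u = \sum_(p <- l) p.2 u *: p.1]].

(** Coefficients are forced, so two expansions can be compared on a common list
    of vectors; this is what makes [expansions] a subspace. *)
Lemma expansion_coef0 l u p : (forall q, q \in l -> B q) ->
  u = \sum_(q <- l) q.2 u *: q.1 -> B p -> p \notin l -> p.2 u = 0.
Proof.
move=> lB -> Bp pl; rewrite -[p.2]/(linear_of (linB Bp) : _ -> _) linear_sum.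
rewrite big1_seq// => q /andP[_ ql].
rewrite linearZ/= [as_linear _ _]dualB//; last exact: lB.
by rewrite -[_ == _]/(p == q); case: eqP ql pl => [-> ->//|_ _ _]; exact: scaler0.
Qed.

Lemma subspace_expansions : subspace expansions.
Proof.
split; first by exists [::]; rewrite big_nil.
move=> k x y [l [ul lB xE]] [l' [ul' lB' yE]].
have uu := undup_uniq (l ++ l').
have uB p : p \in undup (l ++ l') -> B p.
  by rewrite mem_undup mem_cat => /orP[/lB|/lB'].
exists (undup (l ++ l')); split=> //.
rewrite [in LHS]xE [in LHS]yE.
rewrite -(@uniq_sum_widen _ _ l (undup (l ++ l')))//; last 2 first.
- by move=> p pl; rewrite mem_undup mem_cat pl.
- by move=> p /uB Bp pl; rewrite (expansion_coef0 lB xE)// scale0r.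
rewrite -(@uniq_sum_widen _ _ l' (undup (l ++ l')))//; last 2 first.
- by move=> p pl; rewrite mem_undup mem_cat pl orbT.
- by move=> p /uB Bp pl; rewrite (expansion_coef0 lB' yE)// scale0r.
rewrite scaler_sumr -big_split/=; apply: eq_big_seq => p /uB Bp.
by rewrite (linB Bp) scalerDl scalerA.
Qed.

Lemma expansions_vector p : B p -> expansions p.1.
Proof.
move=> Bp; exists [:: p]; split=> //; first by move=> q; rewrite inE => /eqP ->.
by rewrite big_seq1 dualB// eqxx scale1r.
Qed.

End Biorthogonal.

(** * Functionals adapted to a chain of subspaces *)

(** [Y] is a chain of subspaces of [V], and [K] the set of vectors that have to
    be told apart. Each vector of an adapted system comes with a functional that
    is dual to the others and also vanishes on every member of [Y] that misses
    the vector. The vectors play the part of a basis adapted to the chain; in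
    place of spanning, what is wanted is that the functionals detect all of
    [K]. *)
Section SeparatingSystem.
Context (V : lmodType F) (Y : set (set V)) (K : set V).

Definition adapted_system (B : set (V * (V -> F^o))) :=
  [/\ forall p, B p -> K p.1,
      forall p, B p -> linear p.2,
      forall p q, B p -> B q -> p.2 q.1 = (p == q)%:R
    & forall p X y, B p -> Y X -> ~ X p.1 -> X y -> p.2 y = 0].

Lemma adapted_system_bigcup_chain (C : set (set (V * (V -> F^o)))) :
  C `<=` adapted_system -> total_on C subset ->
  adapted_system (\bigcup_(B in C) B).
Proof.
move=> CA tC; split.
- by move=> p [B /CA[+ _ _ _]]; exact.
- by move=> p [B /CA[_ + _ _]]; exact.
- move=> p q [B CB Bp] [B' CB' B'q].
  have [BB'|B'B] := tC _ _ CB CB'.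
    by case: (CA _ CB') => _ _ + _; apply=> //; exact: BB'.
  by case: (CA _ CB) => _ _ + _; apply=> //; exact: B'B.
- by move=> p X y [B /CA[_ _ _ +]]; exact.
Qed.

Hypothesis sY : forall X, Y X -> subspace X.
Hypothesis tY : total_on Y subset.

(** A maximal adapted system detects every vector of [K] outside some member of
    [Y]. If all functionals of the system vanish at such an [x], then [x] is not
    in the sum of the span of the system with the members of [Y] that miss [x]:
    in a decomposition [x = w + u] with [w] in such an [X], a system vector
    outside [X] has a functional killing both [x] and [w], hence [u], so only
    vectors inside [X] occur in [u], and [x] would lie in [X]. A functional
    separating [x] from this sum enlarges the system. *)
Lemma separating_system : exists2 B, adapted_system B &
  forall x, K x -> (forall p, B p -> p.2 x = 0) -> forall X, Y X -> X x.
Proof.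
have [B [aB maxB]] := Zorn_bigcup adapted_system_bigcup_chain.
exists B => // x Kx B0 X0 YX0; apply: contrapT => nX0x.
have [BK linB dualB killB] := aB.
pose L := \bigcup_(X in [set X | Y X /\ ~ X x]) X.
have sL : subspace L.
  apply: subspace_bigcup_chain; first by exists X0.
    by move=> X [/sY].
  by move=> X X' [YX _] [YX' _]; exact: tY.
have sE := subspace_expansions linB dualB.
pose W := [set v | exists w u, [/\ L w, expansions B u & v = w + u]].
have sW : subspace W.
  split; first by exists 0, 0; rewrite addr0; split=> //; [exact: sL.1|exact: sE.1].
  move=> k _ _ [w [u [Lw Eu ->]]] [w' [u' [Lw' Eu' ->]]].
  exists (k *: w + w'), (k *: u + u'); split; [exact: sL.2|exact: sE.2|].
  by rewrite scalerDr addrACA.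
have nWx : ~ W x.
  move=> [w [u [[X [YX nXx] Xw] [l [ul lB uE]] xE]]].
  apply: nXx; rewrite xE; apply: subspaceD => //; first exact: sY.
  rewrite uE big_seq; apply: subspace_sum => [|p /lB Bp]; first exact: sY.
  have [Xp|nXp] := pselect (X p.1); first by apply: subspaceZ => //; exact: sY.
  have := B0 _ Bp; rewrite xE -[p.2]/(linear_of (linB _ Bp) : _ -> _) linearD/=.
  rewrite [as_linear _ w](killB _ _ _ Bp YX nXp Xw) add0r => ->.
  by rewrite scale0r; exact: (sY YX).1.
have [f [fW fx]] := separating_functional sW nWx.
have nBxf : ~ B (x, f : V -> F^o).
  by move=> /B0/=/eqP; rewrite fx oner_eq0.
apply: (maxB ((x, f : V -> F^o) |` B)).
  by split; [right|move=> h; apply: nBxf; apply: h; left].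
split.
- by move=> p [->|/BK].
- by move=> p [->|/linB//]; exact: linearP.
- move=> p q [->|Bp] [->|Bq]/=.
  + by rewrite fx eqxx.
  + rewrite fW; last first.
      exists 0, q.1; rewrite add0r; split=> //; [exact: sL.1|exact: expansions_vector].
    by case: eqP => // qE; case: nBxf; rewrite qE.
  + by rewrite B0//; case: eqP => // pE; case: nBxf; rewrite -pE.
  + exact: dualB.
- move=> p X y [->|Bp] YX nXp Xy /=; last exact: killB Xy.
  by apply: fW; exists y, 0; rewrite addr0; split=> //; [exists X|exact: sE.1].
Qed.

End SeparatingSystem.

(** * Ranks *)

(** Rank as a supremum of sizes of independent families, which makes sense for
    maps between spaces of infinite dimension. *)
Definition rank_ge U V (f : {linear U -> V}) (k : nat) :=
  exists x : 'I_k -> U, forall c : 'I_k -> F,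
    \sum_i c i *: f (x i) = 0 -> forall i, c i = 0.

Lemma rank_ge_bound U V (f : {linear U -> V}) (n k : nat) (v : 'I_n -> V) :
  (forall x, exists c : 'I_n -> F, f x = \sum_i c i *: v i) ->
  rank_ge f k -> (k <= n)%N.
Proof.
move=> fv [x indep]; have [C CE] := choice (fun i => fv (x i)).
rewrite leqNgt; apply/negP => nk.
pose M := \matrix_(i < k, j < n) C i j.
have : kermx M != 0.
  rewrite kermx_eq0; apply/negP => /eqP rM.
  by have := rank_leq_col M; rewrite rM leqNgt nk.
case/rowV0Pn => r /sub_kermxP rM /eqP[]; apply/rowP => i; rewrite mxE.
apply: (indep (r 0)); under eq_bigr => j _ do rewrite CE scaler_sumr.
rewrite exchange_big big1//= => m _.
under eq_bigr => j _ do rewrite scalerA.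
have : (r *m M) 0 m = 0 by rewrite rM mxE.
rewrite -scaler_suml mxE; under eq_bigr do rewrite mxE.
by move=> ->; rewrite scale0r.
Qed.

End LinearAlgebra.

Section Enumerations.

Lemma bounded_enumeration (A : eqType) (S : set A) (n : nat) :
  (forall l, uniq l -> (forall a, a \in l -> S a) -> (size l <= n)%N) ->
  exists2 l, uniq l & forall a, a \in l <-> S a.
Proof.
move=> Sn.
pose P k := `[< exists l, [/\ uniq l, forall a, a \in l -> S a & size l = k] >].
have exP : exists k, P k by exists 0%N; apply/asboolP; exists [::].
have Pn k : P k -> (k <= n)%N by move=> /asboolP[l [ul lS <-]]; exact: Sn.
case: (ex_maxnP exP Pn) => k /asboolP[l [ul lS lk]] maxk.
exists l => // a; split=> [/lS//|Sa]; apply: contrapT => /negP al.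
have : P k.+1.
  apply/asboolP; exists (a :: l); split; rewrite /= ?al ?lk//.
  by move=> b; rewrite inE => /orP[/eqP->|/lS].
by move=> /maxk; rewrite ltnn.
Qed.

Lemma rank_ge_biorthogonal (F : fieldType) (U V : lmodType F)
    (f : {linear U -> V}) (A : eqType) (l : seq A) (x : A -> U)
    (psi : A -> {linear V -> F^o}) :
  uniq l ->
  (forall a b, a \in l -> b \in l -> psi a (f (x b)) = (a == b)%:R) ->
  rank_ge f (size l).
Proof.
move=> ul dual; pose ll := in_tuple l.
exists (fun i => x (tnth ll i)) => c c0 i.
have : psi (tnth ll i) (\sum_j c j *: f (x (tnth ll j))) = 0.
  by rewrite c0 linear0.
rewrite linear_sum (bigD1 i)//= linearZ/= dual ?mem_tnth// eqxx.
rewrite big1 ?addr0; first by rewrite /GRing.scale/= mulr1.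
move=> j ji; rewrite linearZ/= dual ?mem_tnth//.
have -> : (tnth ll i == tnth ll j) = false; last by rewrite scaler0.
apply/negbTE; apply: contra ji => /eqP/tuple_uniqP -> //.
Qed.

End Enumerations.

(** * Structure maps and upper semi-continuity *)

Section TotalMap.
Context (F : fieldType) (d : Order.disp_t) (T : orderType d) (M : persmod F T).

(** Total in the pair of indices, so that terms carry no order proofs. *)
Definition tmap (s t : T) : {linear M s -> M t} :=
  if pselect (s <= t)%O is left st then pm_map M st else \0.

Lemma tmapE s t (st : (s <= t)%O) : tmap s t = pm_map M st.
Proof.
rewrite /tmap; case: pselect => [h|n] //=.
by congr (pm_map M _); exact: bool_irrelevance.
Qed.

Lemma tmap_id t x : tmap t t x = x.
Proof. by rewrite (tmapE (lexx t)) pm_map_id. Qed.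

Lemma tmap_comp s t u x : (s <= t)%O -> (t <= u)%O ->
  tmap t u (tmap s t x) = tmap s u x.
Proof.
move=> st tu; rewrite (tmapE st) (tmapE tu) (tmapE (le_trans st tu)).
exact: pm_map_comp.
Qed.

Lemma q_tame_rank_bound : q_tame M -> forall s t, (s < t)%O ->
  exists n, forall k, rank_ge (tmap s t) k -> (k <= n)%N.
Proof.
move=> qM s t st; have [n [u uP]] := qM _ _ st; exists n => k.
rewrite (tmapE (ltW st)); apply: rank_ge_bound => x; have [c cE] := uP x.
by exists c; exact: cE.
Qed.

Lemma usc_separated : upper_semicontinuous M -> forall t (x : M t),
  x <> 0 -> exists2 u, (t < u)%O & tmap t u x <> 0.
Proof.
move=> uM t x x0; apply: contrapT => nu; apply: x0.
apply: (bij_inj (uM t)); rewrite linear0; apply: val_inj => /=.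
apply: functional_extensionality_dep => -[u tu] /=; rewrite /restrict_above/=.
rewrite -tmapE; apply: contrapT => xu; apply: nu; exists u => //.
Qed.

Lemma usc_gluing : upper_semicontinuous M -> forall t (y : forall s, M s),
  (forall r s, (t < r)%O -> (r <= s)%O -> tmap r s (y r) = y s) ->
  exists x : M t, forall s, (t < s)%O -> tmap t s x = y s.
Proof.
move=> uM t y yc; have [g gK Kg] := uM t.
have cy : (fun s => y (sval s) : M (sval s)) \in compatible (M := M) (t := t).
  by apply/asboolP => -[r tr] [s ts] /= rs; rewrite -tmapE; exact: yc.
exists (g (LimAbove cy)) => s ts.
have /(congr1 val)/= := Kg (LimAbove cy).
move=> /(congr1 (fun h => h (exist _ s ts)))/=.
by rewrite /restrict_above/= -tmapE.
Qed.

End TotalMap.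

(** * Cuts and germs *)

Section Cuts.
Context (d : Order.disp_t) (T : orderType d).

(** The possible upper ends of the intervals: by upper semi-continuity the set of
    indices up to which an element survives has no maximum. *)
Definition open_cut (D : set T) :=
  [/\ D !=set0, forall s t, D t -> (s <= t)%O -> D s
    & forall t, D t -> exists2 u, D u & (t < u)%O].

Lemma open_cut_total (D E : set T) : open_cut D -> open_cut E -> D `<=` E \/ E `<=` D.
Proof.
move=> [_ dD _] [_ dE _].
have [DE|nDE] := pselect (D `<=` E); [by left|right=> t Et].
apply: contrapT => nDt; apply: nDE => s Ds.
apply: (dE _ _ Et); rewrite leNgt; apply/negP => /ltW ts.
by apply: nDt; exact: dD ts.
Qed.

Lemma open_cut_max (D : set T) (s t : T) : D s -> D t -> D (Order.max s t).
Proof. by rewrite /Order.max; case: ifP. Qed.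

Lemma open_cut_lt (D : set T) (s t : T) : open_cut D -> D s -> ~ D t -> (s < t)%O.
Proof.
move=> [_ dD _] Ds nDt; rewrite ltNge; apply/negP => ts.
by apply: nDt; exact: dD ts.
Qed.

End Cuts.

Section Existence.
Context (F : fieldType) (d : Order.disp_t) (T : orderType d) (M : persmod F T).

Local Notation V := (lmod_prod (fun t => M t)).

(** The product of all the [M t] serves as one ambient space for the colimits of
    [M] over all cuts [D]: modulo the families [vanishing] near the top of [D],
    [germ x] is the class of [x] in the colimit over [D]. This avoids quotients:
    a functional that kills [vanishing] restricts to one on the colimit. *)
Definition germ (t : T) (x : M t) : V := fun u => tmap M t u x.

Lemma germ_linear t : linear (@germ t).
Proof. by move=> k x y; apply: functional_extensionality_dep => u; exact: linearP. Qed.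

HB.instance Definition _ t :=
  GRing.isLinear.Build F (M t) V *:%R (@germ t) (@germ_linear t).

Section Cut.
Context (D : set T) (cD : open_cut D).

Definition vanishing : set V :=
  [set v | exists2 u, D u & forall w, D w -> (u <= w)%O -> v w = 0].

(** The image of [M t] in the colimit, as a preimage in the ambient space. *)
Definition reached (t : T) : set V :=
  [set v | exists x : M t, vanishing (v - germ x)].

Lemma subspace_vanishing : subspace vanishing.
Proof.
split; first by case: cD => -[u Du] _ _; exists u.
move=> k x y [u Du xu] [u' Du' yu'].
exists (Order.max u u'); first exact: open_cut_max.
move=> w Dw; rewrite ge_max => /andP[uw u'w].
have -> : (k *: x + y) w = k *: x w + y w by [].
by rewrite xu// yu'// scaler0 addr0.
Qed.

Lemma subspace_reached t : subspace (reached t).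
Proof.
have sV := subspace_vanishing.
split; first by exists 0; rewrite linear0 subr0; exact: sV.1.
move=> k v w [x vx] [y wy]; exists (k *: x + y).
have -> : k *: v + w - germ (k *: x + y) = k *: (v - germ x) + (w - germ y).
  by rewrite linearP scalerBr opprD addrACA.
exact: sV.2.
Qed.

Lemma vanishing_shift s t (x : M s) : (s <= t)%O -> D t ->
  vanishing (germ x - germ (tmap M s t x)).
Proof.
move=> st Dt; exists t => // w Dw tw.
have -> : (germ x - germ (tmap M s t x)) w = tmap M s w x - tmap M t w (tmap M s t x).
  by [].
by rewrite tmap_comp// subrr.
Qed.

Lemma vanishing_reached t : vanishing `<=` reached t.
Proof. by move=> v Zv; exists 0; rewrite linear0 subr0. Qed.

Lemma reached_germ t (x : M t) : reached t (germ x).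
Proof. by exists x; rewrite subrr; exact: subspace_vanishing.1. Qed.

Lemma reached_le s t : (s <= t)%O -> D t -> reached s `<=` reached t.
Proof.
move=> st Dt v [x vx]; exists (tmap M s t x).
rewrite -[v](subrK (germ x)) -addrA; apply: subspaceD => //.
  exact: subspace_vanishing.
exact: vanishing_shift.
Qed.

(** The images of the [M t] in the colimit over [D], for [t] in [D]; the zero
    subspace of the colimit is added so that adapted functionals descend to it. *)
Definition flag : set (set V) :=
  [set X | X = vanishing \/ exists2 t, D t & X = reached t].

Lemma flag_subspace X : flag X -> subspace X.
Proof.
by move=> [->|[t _ ->]]; [exact: subspace_vanishing|exact: subspace_reached].
Qed.

Lemma flag_total : total_on flag subset.
Proof.
move=> X Y [->|[s Ds ->]] [->|[t Dt ->]].
- by left.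
- by left; exact: vanishing_reached.
- by right; exact: vanishing_reached.
- by have /orP[st|ts] := le_total s t; [left|right]; exact: reached_le.
Qed.

(** Nonzero classes of the colimit that die at every index beyond [D]: these are
    the classes on which intervals with upper end [D] are detected. *)
Definition ending : set V :=
  [set v | ~ vanishing v /\ exists t (x : M t),
    [/\ D t, v = germ x & forall u, ~ D u -> tmap M t u x = 0]].

(** Two representatives of a class over [D] agree on some [w] in [D], and every
    index beyond [D] is above [w], so dying beyond [D] does not depend on the
    representative. *)
Lemma ending_representative v t : ending v -> reached t v -> D t ->
  exists x : M t, vanishing (v - germ x) /\ forall u, ~ D u -> tmap M t u x = 0.
Proof.
move=> [_ [r [y [Dr -> y0]]]] [x [u0 Du0 xu0]] Dt.
exists x; split=> [|u nDu]; first by exists u0.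
pose w := Order.max u0 (Order.max r t).
have Dw : D w by do 2!apply: open_cut_max => //.
have wu : (w <= u)%O by apply/ltW/(open_cut_lt cD).
have [u0w rw tw] : [/\ u0 <= w, r <= w & t <= w]%O.
  by rewrite /w !le_max !lexx !orbT.
have /eqP : germ y w - germ x w = 0 by exact: xu0.
rewrite subr_eq0 => /eqP yx.
rewrite -(tmap_comp _ tw wu) -[tmap M t w x]/(germ x w) -yx.
by rewrite [tmap M _ _ _](tmap_comp y rw wu) y0.
Qed.

End Cut.

Lemma separating_systems : exists B : set T -> set (V * (V -> F^o)),
  forall D, open_cut D -> adapted_system (flag D) (ending D) (B D) /\
    forall x, ending D x -> exists2 p, B D p & p.2 x <> 0.
Proof.
suff /choice[B BP] : forall D, exists B : set (V * (V -> F^o)), open_cut D ->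
    adapted_system (flag D) (ending D) B /\
    forall x, ending D x -> exists2 p, B p & p.2 x <> 0 by exists B.
move=> D; have [cD|ncD] := pselect (open_cut D); last by exists set0.
have [B aB sB] := separating_system (ending D) (flag_subspace cD) (flag_total cD).
exists B => _; split=> // x Ex; apply: contrapT => nB.
case: (Ex) => nZx _; apply: nZx; apply: (sB x Ex) => [p Bp|]; last by left.
by apply: contrapT => px; apply: nB; exists p.
Qed.

(** * The bars of a module and their coordinates *)

Section Bars.
Variable B : set T -> set (V * (V -> F^o)).
Hypothesis adB : forall D, open_cut D -> adapted_system (flag D) (ending D) (B D).
Hypothesis sepB :
  forall D x, open_cut D -> ending D x -> exists2 p, B D p & p.2 x <> 0.

(** A bar is an upper end [D] with a member [(e, phi)] of the separating system
    for [D]. Its interval consists of the indices of [D] whose image contains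
    [e], and [phi] provides the coordinate along it. *)
Definition bar := {a : set T * (V * (V -> F^o)) | open_cut a.1 /\ B a.1 a.2}.

HB.instance Definition _ := gen_eqMixin bar.

Implicit Types (a b : bar).
Local Notation cut a := ((sval a).1).
Local Notation vec a := ((sval a).2.1).
Local Notation fct a := ((sval a).2.2).

Let bar_cut a : open_cut (cut a). Proof. exact: (svalP a).1. Qed.
Let bar_in a : B (cut a) (sval a).2. Proof. exact: (svalP a).2. Qed.

Let bar_ending a : ending (cut a) (vec a).
Proof. by have [h _ _ _] := adB (bar_cut a); exact/h/bar_in. Qed.

Lemma bar_linear a : linear (fct a).
Proof. by have [_ h _ _] := adB (bar_cut a); exact/h/bar_in. Qed.

Lemma bar_kill a X v : flag (cut a) X -> ~ X (vec a) -> X v -> fct a v = 0.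
Proof. by have [_ _ _ h] := adB (bar_cut a); apply: h; exact: bar_in. Qed.

Definition bar_coord a t : {linear M t -> F^o} := linear_of (bar_linear a) \o @germ t.

Lemma bar_coordE a t (x : M t) : bar_coord a t x = fct a (germ x).
Proof. by []. Qed.

Lemma bar_coord_addZ a t (x y : M t) k :
  bar_coord a t (x + k *: y) = bar_coord a t x + k * bar_coord a t y.
Proof. by rewrite linearD linearZ. Qed.

Definition bar_set a : set T := [set t | cut a t /\ reached (cut a) t (vec a)].

Lemma fct_vanishing_eq a v w : vanishing (cut a) (v - w) -> fct a v = fct a w.
Proof.
move=> Zvw; apply/eqP; rewrite -subr_eq0; apply/eqP.
have := @bar_kill a _ _ (or_introl erefl) (bar_ending a).1 Zvw.
by rewrite -[fct a (v - w)]/(linear_of (bar_linear a) (v - w)) linearB.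
Qed.

(** Together with [bar_coord_unborn] this says that the coordinates of a bar form
    a morphism to its interval module. *)
Lemma bar_coord_shift a s t (x : M s) : (s <= t)%O -> cut a t ->
  bar_coord a t (tmap M s t x) = bar_coord a s x.
Proof.
by move=> st at_; symmetry; apply: fct_vanishing_eq; exact: vanishing_shift.
Qed.

Lemma bar_coord_unborn a t (x : M t) : cut a t -> ~ bar_set a t -> bar_coord a t x = 0.
Proof.
move=> at_ nat_; rewrite bar_coordE; apply: (@bar_kill a (reached (cut a) t)).
- by right; exists t.
- by move=> r; apply: nat_.
- exact/reached_germ/bar_cut.
Qed.

Lemma bar_set_convex a s u t :
  bar_set a s -> bar_set a t -> (s <= u <= t)%O -> bar_set a u.
Proof.
move=> [_ sr] [at_ _] /andP[su ut].
have au : cut a u by case: (bar_cut a) => _ + _; apply; [exact: at_|exact: ut].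
by split=> //; apply: reached_le sr => //; exact: bar_cut.
Qed.

Lemma bar_set_nonempty a : bar_set a !=set0.
Proof.
have [_ [t [x [at_ aE _]]]] := bar_ending a.
by exists t; split=> //; rewrite aE; exact/reached_germ/bar_cut.
Qed.

Definition bar_interval a : order_interval T :=
  OrderInterval (bar_set_nonempty a) (@bar_set_convex a).

Lemma bar_set_open a t : bar_set a t -> exists2 s, bar_set a s & (t < s)%O.
Proof.
move=> [at_ tr]; have [_ _ /(_ _ at_)[s as_ ts]] := bar_cut a.
exists s => //; split=> //; exact: reached_le (bar_cut a) _ _ (ltW ts) as_ _ tr.
Qed.

Hypothesis usc_M : upper_semicontinuous M.

(** The indices at which [x] has not died form an open cut with respect to which
    [germ x] is [ending], so the separating system for that cut sees [x]. *)
Lemma bar_coord_separated t s (x : M t) : (t <= s)%O -> tmap M t s x <> 0 ->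
  exists a, [/\ bar_set a t, bar_set a s & bar_coord a t x <> 0].
Proof.
move=> ts xs; pose D := [set u | (u <= t)%O \/ tmap M t u x <> 0].
have Dle u : (t <= u)%O -> D u -> tmap M t u x <> 0.
  move=> tu [ut|//]; have -> : u = t by apply/le_anti; rewrite ut.
  by move=> xt; apply: xs; rewrite -(tmap_comp x (lexx t) ts) xt linear0.
have cD : open_cut D.
  split; first by exists t; left.
    move=> r u [ut|xu] ru; first by left; exact: le_trans ut.
    have [/ltW rt|tr] := ltP r t; [by left|right=> xr; apply: xu].
    by rewrite -(tmap_comp x tr ru) xr linear0.
  move=> u Du; pose w := Order.max t u.
  have tw : (t <= w)%O by rewrite le_max lexx.
  have Dw : D w by apply: open_cut_max => //; left.
  have [v wv xv] := usc_separated usc_M (Dle _ tw Dw).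
  exists v; last by apply: le_lt_trans wv; rewrite le_max lexx orbT.
  by right; move: xv; rewrite tmap_comp// ltW.
have Ex : ending D (germ x).
  split.
    move=> [u Du xu]; pose w := Order.max t u.
    have Dw : D w by apply: open_cut_max => //; left.
    by apply: (Dle w) => //; [rewrite le_max lexx|apply: xu; rewrite // le_max lexx orbT].
  exists t, x; split=> //; first by left.
  by move=> u nDu; apply: contrapT => xu; apply: nDu; right.
have [p Bp px] := sepB cD Ex.
pose a : bar := exist _ (D, p) (conj cD Bp).
have Dt : D t by left.
have at_ : bar_set a t.
  by apply: contrapT => nat_; apply: px; exact: (@bar_coord_unborn a t x).
have Ds : D s by right.
by exists a; split=> //; split=> //; exact: reached_le cD _ _ ts Ds _ at_.2.
Qed.

(** A representative of the vector of [a] at [t] dies beyond the upper end of [a],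
    so it is invisible to bars with a larger upper end, and biorthogonality
    handles the bars with the same one. *)
Lemma bar_coord_triangular a t : bar_set a t ->
  exists x : M t, forall b, bar_set b t -> cut a `<=` cut b ->
    bar_coord b t x = (a == b)%:R.
Proof.
move=> [at_ tr].
have [x [xa x0]] := ending_representative (bar_cut a) (bar_ending a) tr at_.
exists x => b [bt _] ab; have [ba|nba] := pselect (cut b `<=` cut a).
  have cutE : cut a = cut b by apply/seteqP.
  rewrite bar_coordE -(@fct_vanishing_eq b (vec a)) -?cutE//.
  have [_ _ h _] := adB (bar_cut b); rewrite h; last 2 first.
  - exact: bar_in.
  - by rewrite -cutE; exact: bar_in.
  congr (_%:R); congr (nat_of_bool _); apply/eqP/eqP => [pE|->//].
  apply: eq_sig_hprop => [?|]; first exact: Prop_irrelevance.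
  by case: (sval a) (sval b) cutE pE => ? ? [? ?] /= -> ->.
have [u [bu nau]] : exists u, cut b u /\ ~ cut a u.
  apply: contrapT => nu; apply: nba => u bu.
  by apply: contrapT => nau; apply: nu; exists u.
have tu : (t <= u)%O := ltW (open_cut_lt (bar_cut a) at_ nau).
rewrite -(bar_coord_shift x tu bu) x0// linear0.
by have [ab'|//] := eqVneq a b; case: nau; rewrite ab'.
Qed.

(** Triangular elimination, along the order of the upper ends. *)
Lemma bar_coord_solvable t (l : seq bar) (c : bar -> F) : uniq l ->
  (forall a, a \in l -> bar_set a t) ->
  exists x : M t, forall a, a \in l -> bar_coord a t x = c a.
Proof.
pose r : rel bar := fun a b => `[< cut a `<=` cut b >].
have r_total : total r.
  move=> a b; have [ab|ba] := open_cut_total (bar_cut a) (bar_cut b).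
    by apply/orP; left; exact/asboolP.
  by apply/orP; right; exact/asboolP.
have r_trans : transitive r.
  by move=> b a e /asboolP ab /asboolP be; apply/asboolP; exact: subset_trans be.
wlog : l / sorted r l.
  move=> sol ul lt; have [|||x xl] := sol (sort r l).
  - exact: sort_sorted.
  - by rewrite sort_uniq.
  - by move=> a; rewrite mem_sort; exact: lt.
  - by exists x => a al; apply: xl; rewrite mem_sort.
elim: l => [|a l IH] sl; first by exists 0.
rewrite cons_uniq => /andP[nal ul] lt.
have lt' b : b \in l -> bar_set b t by move=> bl; apply: lt; rewrite inE bl orbT.
have [x xl] := IH (path_sorted sl) ul lt'.
have at_ : bar_set a t by apply: lt; exact: mem_head.
have [y ya] := bar_coord_triangular at_.
exists (x + (c a - bar_coord a t x) *: y) => b; rewrite bar_coord_addZ => /predU1P[->|bl].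
  by rewrite ya// eqxx mulr1 addrC subrK.
rewrite xl// ya; last 2 first.
- exact: lt'.
- by apply/asboolP; move: sl => /(order_path_min r_trans)/allP/(_ _ bl).
have [ab|_] := eqVneq a b; first by case/negP: nal; rewrite ab.
by rewrite mulr0 addr0.
Qed.

Hypothesis qtame_M : q_tame M.

(** Coordinates of distinct such bars are independent on the image of [M t] in [M s],
    which has finite rank. *)
Lemma bars_through_finite t s : (t < s)%O ->
  exists2 l : seq bar, uniq l & forall a, a \in l <-> bar_set a t /\ bar_set a s.
Proof.
move=> ts; have [n nP] := q_tame_rank_bound qtame_M ts.
apply: (@bounded_enumeration _ [set a | bar_set a t /\ bar_set a s] n) => l ul lS.
apply: nP.
have /choice[x xP] : forall b, exists x : M t, forall a, a \in l ->
    bar_coord a t x = (a == b)%:R.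
  by move=> b; apply: bar_coord_solvable => // a /lS[].
apply: (@rank_ge_biorthogonal _ _ _ _ _ _ x (fun a => bar_coord a s)) => // a b al bl.
by rewrite bar_coord_shift ?ltW//; [exact: xP|case: (lS _ al) => _ []].
Qed.

(** At each [s > t] only finitely many bars through [t] and [s] matter, so some
    element of the image of [M t] has the prescribed coordinates there. It is
    unique by separation, so these elements are compatible and glue. *)
Lemma bar_coord_onto t (c : bar -> F) :
  exists x : M t, forall a, bar_set a t -> bar_coord a t x = c a.
Proof.
have yH : forall s, exists y : M s, (t < s)%O ->
    exists x : M t, y = tmap M t s x /\
      forall a, bar_set a t -> bar_set a s -> bar_coord a t x = c a.
  move=> s; have [ts|_] := boolP (t < s)%O; last by exists 0.
  have [l ul lP] := bars_through_finite ts.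
  have [|x xl] := bar_coord_solvable (t := t) c ul; first by move=> a /lP[].
  exists (tmap M t s x) => _; exists x; split=> // a at_ as_.
  by apply: xl; apply/lP.
have [y yP] : exists y : forall s, M s, forall s, (t < s)%O ->
    exists x : M t, y s = tmap M t s x /\
      forall a, bar_set a t -> bar_set a s -> bar_coord a t x = c a.
  by exists (fun s => projT1 (cid (yH s))) => s; exact: projT2 (cid (yH s)).
have [|x xy] := usc_gluing usc_M (t := t) (y := y).
  move=> r s tr rs; have ts := lt_le_trans tr rs.
  have [x [-> xc]] := yP _ tr; have [x' [-> x'c]] := yP _ ts.
  rewrite (tmap_comp _ (ltW tr) rs); apply: contrapT => ne.
  have [|a [at_ as_]] := @bar_coord_separated t s (x - x') (ltW ts).
    by rewrite linearB => /eqP; rewrite subr_eq0 => /eqP.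
  have ar : bar_set a r by apply: (bar_set_convex at_ as_); rewrite (ltW tr).
  by rewrite linearB xc// x'c// subrr.
exists x => a at_; have [s as_ ts] := bar_set_open at_.
have [x' [yE x'c]] := yP _ ts.
rewrite -(bar_coord_shift _ (ltW ts) as_.1) xy// yE.
by rewrite bar_coord_shift ?(ltW ts)//; [exact: x'c|exact: as_.1].
Qed.

End Bars.
End Existence.

(** * Existence of the decomposition *)

Section Decomposition.
Context (F : fieldType) (d : Order.disp_t) (T : orderType d).
Implicit Types (M N : persmod F T) (U V : lmodType F).

Lemma injective_onto_bijective (X Y : Type) (f : X -> Y) :
  injective f -> (forall y, exists x, f x = y) -> bijective f.
Proof. by move=> fI /choice[g fK]; exists g => // x; apply: fI; rewrite fK. Qed.

Lemma linear_bijection_inverse (U V : lmodType F) (f : {linear U -> V}) :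
  bijective f -> exists g : {linear V -> U}, cancel f g /\ cancel g f.
Proof.
move=> [g fK gK]; have lg : linear g.
  by move=> k x y; apply: (can_inj fK); rewrite linearP !gK.
by exists (linear_of lg).
Qed.

Lemma bijective_persmod_iso M N (f : persmod_hom M N) :
  (forall t, bijective (f t)) -> persmod_iso M N.
Proof.
move=> bf; have gH t := linear_bijection_inverse (bf t).
pose g t := projT1 (cid (gH t)).
have fgK t : cancel (f t) (g t) /\ cancel (g t) (f t) := projT2 (cid (gH t)).
have gN s t st x : g t (pm_map N st x) = pm_map M st (g s x).
  by apply: (can_inj (fgK t).1); rewrite (fgK t).2 pm_hom_nat (fgK s).2.
by exists f, (PersModHom gN).
Qed.

Definition cell_lift U (b : bool) (f : {linear U -> F^o}) : {linear U -> cell F b} :=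
  match b return {linear U -> cell F b} with true => f | false => \0 end.

Definition cell_value (b : bool) : {linear cell F b -> F^o} :=
  match b return {linear cell F b -> F^o} with true => idfun | false => \0 end.

Lemma cell_liftP U (b : bool) (f : {linear U -> F^o}) (x : U) (y : cell F b) :
  (b -> f x = cell_value b y) <-> cell_lift b f x = y.
Proof.
case: b y => y /=; first by split=> [/(_ isT)|yE _].
by split=> // _; apply/rowP => -[].
Qed.

Lemma cell_lift_natural U V (b c : bool)
    (f : {linear U -> F^o}) (g : {linear V -> F^o}) x y :
  (c -> b -> g y = f x) -> (c -> ~~ b -> g y = 0) ->
  cell_lift c g y = cell_map F b c (cell_lift b f x).
Proof.
case: b c => [] [] //= h h'; [exact: h|exact: h'].
Qed.

Lemma usc_q_tame_decomposition M : q_tame M -> upper_semicontinuous M ->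
  exists (A : Type) (I : A -> order_interval T),
    persmod_iso M (persmod_prod (fun a => interval_module F (I a))).
Proof.
move=> qM uM; have [B BP] := separating_systems M.
have adB D (cD : open_cut D) := (BP D cD).1.
have sepB D x (cD : open_cut D) := (BP D cD).2 x.
exists (bar B), (bar_interval adB).
set N := persmod_prod _.
pose h t (x : M t) : N t := fun a => cell_lift (t \in bar_set a) (bar_coord adB a t) x.
have lh t : linear (@h t).
  by move=> k x y; apply: functional_extensionality_dep => a; exact: linearP.
have hN s t (st : (s <= t)%O) (x : M s) :
    linear_of (lh t) (pm_map M st x) = pm_map N st (linear_of (lh s) x).
  apply: functional_extensionality_dep => a.
  apply: cell_lift_natural; rewrite -tmapE !inE => at_.
    by move=> _; exact: bar_coord_shift at_.1.
  move=> /negP; rewrite inE => nas; rewrite bar_coord_shift//; last exact: at_.1.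
  apply: bar_coord_unborn => //; case: at_ => at_ _.
  by case: (svalP a) => -[_ + _] _; apply; [exact: at_|].
apply: (@bijective_persmod_iso _ _ (PersModHom hN)) => t /=.
apply: injective_onto_bijective.
  move=> x y xy; apply: contrapT => ne.
  have [|a [at_ _ xya]] :=
      @bar_coord_separated _ _ _ _ _ adB sepB uM t t (x - y) (lexx t).
    by rewrite tmap_id => /eqP; rewrite subr_eq0 => /eqP.
  have tb : t \in bar_set a by rewrite inE.
  apply: xya; rewrite linearB; apply/eqP; rewrite subr_eq0; apply/eqP.
  have : h t x a = h t y a by exact: (congr1 (fun z : N t => z a) xy).
  move=> /cell_liftP/(_ tb) ->; symmetry.
  by move: tb; exact/cell_liftP.
move=> y; have [x xy] := bar_coord_onto adB sepB uM qM t (fun a => cell_value _ (y a)).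
exists x; apply: functional_extensionality_dep => a.
by apply/cell_liftP; rewrite inE; exact: xy.
Qed.

End Decomposition.

(** * Finite multisets of intervals *)

Section Multisets.

Lemma maximal_member (X : eqType) (r : X -> X -> Prop) (s : seq X) :
  (forall x y z, r x y -> r y z -> r x z) -> s != [::] ->
  exists2 x, x \in s & forall y, y \in s -> r x y -> r y x.
Proof.
move=> r_trans; elim: s => // x s IH _.
have [->|/IH[m ms max_m]] := eqVneq s [::].
  by exists x; rewrite ?inE// => y; rewrite inE => /eqP ->.
have [mx|nmx] := pselect (r m x /\ ~ r x m).
  exists x; rewrite ?inE ?eqxx// => y; rewrite inE => /predU1P[->//|ys xy].
  exact: r_trans (max_m _ ys (r_trans _ _ _ mx.1 xy)) mx.1.
exists m; first by rewrite inE ms orbT.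
move=> y; rewrite inE => /predU1P[->|/max_m//] mx.
by apply: contrapT => nxm; apply: nmx.
Qed.

Context (d : Order.disp_t) (T : orderType d).
Implicit Types (X Y : set T) (k l : seq (set T)).

Definition convex_around (s t : T) X :=
  [/\ X s, X t & forall p u q, X p -> X q -> (p <= u <= q)%O -> X u].

Definition through (p q : T) : pred (set T) := fun X => `[< X p /\ X q >].

(** Each member of [l] that does not contain [X] is excluded by moving [p] down or
    [q] up to a point of [X] that it misses. *)
Lemma detecting_points (s t : T) X l : (s <= t)%O -> convex_around s t X ->
  (forall Y, Y \in l -> convex_around s t Y) ->
  exists p q, [/\ (p <= s)%O, (t <= q)%O, X p, X q
    & forall Y, Y \in l -> Y p -> Y q -> X `<=` Y].
Proof.
move=> st [Xs Xt cX]; elim: l => [|Y l IH] cl; first by exists s, t.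
have [|p [q [ps tq Xp Xq pqP]]] := IH.
  by move=> Z Zl; apply: cl; rewrite inE Zl orbT.
have [Ys Yt cY] := cl _ (mem_head _ _).
have [XY|nXY] := pselect (X `<=` Y).
  by exists p, q; split=> // Z; rewrite inE => /predU1P[->//|]; exact: pqP.
have [x [Xx nYx]] : exists x, X x /\ ~ Y x.
  apply: contrapT => nx; apply: nXY => x Xx; apply: contrapT => nYx.
  by apply: nx; exists x.
have [xs|sx] := ltP x s.
  exists (Order.min p x), q; split=> //.
  - by rewrite ge_min ps.
  - by rewrite /Order.min; case: ifP.
  move=> Z; rewrite inE => /predU1P[->|Zl] Zp Zq.
    by case: nYx; apply: (cY _ _ _ Zp Ys); rewrite ge_min lexx orbT/= ltW.
  apply: (pqP _ Zl) => //.
  have [Zs _ cZ] : convex_around s t Z by apply: cl; rewrite inE Zl orbT.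
  by apply: (cZ _ _ _ Zp Zs); rewrite ge_min lexx.
have tx : (t < x)%O.
  by rewrite ltNge; apply/negP => xt; apply: nYx; apply: (cY _ _ _ Ys Yt); rewrite sx.
exists p, (Order.max q x); split=> //.
- by rewrite le_max tq.
- by rewrite /Order.max; case: ifP.
move=> Z; rewrite inE => /predU1P[->|Zl] Zp Zq.
  by case: nYx; apply: (cY _ _ _ Yt Zq); rewrite le_max lexx orbT ltW.
apply: (pqP _ Zl) => //.
have [_ Zt cZ] : convex_around s t Z by apply: cl; rewrite inE Zl orbT.
by apply: (cZ _ _ _ Zt Zq); rewrite le_max lexx tq.
Qed.

(** An inclusion-maximal member [X] of either list is the only one to contain a
    suitable pair [p], [q], so its multiplicity is one of the given counts.
    Removing one copy of [X] from both lists preserves the hypothesis. *)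
Lemma perm_eq_through (s t : T) k l : (s <= t)%O ->
  (forall X, X \in k ++ l -> convex_around s t X) ->
  (forall p q, (p <= s)%O -> (t <= q)%O ->
    count (through p q) k = count (through p q) l) ->
  perm_eq k l.
Proof.
move=> st; have [n] := ubnP (size k); elim: n k l => // n IH k l kn cP ckl.
have ck X : X \in k -> convex_around s t X.
  by move=> Xk; apply: cP; rewrite mem_cat Xk.
have cl X : X \in l -> convex_around s t X.
  by move=> Xl; apply: cP; rewrite mem_cat Xl orbT.
have [kl0|nkl] := eqVneq (k ++ l) [::].
  by move: kl0; case: k {kn cP ckl ck} => //=; case: l {cl}.
have subT X Y Z : X `<=` Y -> Y `<=` Z -> X `<=` Z by exact: subset_trans.
have [X Xkl maxX] := maximal_member subT nkl.
have [p [q [ps tq Xp Xq pqP]]] := detecting_points st (cP _ Xkl) cP.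
have countX m : {subset m <= k ++ l} -> count (through p q) m = count_mem X m.
  move=> mkl; apply: eq_in_count => Y /mkl Ykl /=.
  apply/asboolP/eqP => [[Yp Yq]|->//].
  have XY := pqP _ Ykl Yp Yq; apply/seteqP; split=> //; exact: maxX.
have Xck : count_mem X k = count_mem X l.
  rewrite -!countX ?ckl// => Y Yin; rewrite mem_cat Yin ?orbT//.
have Xk : X \in k.
  by move: Xkl; rewrite mem_cat => /orP[//|]; rewrite -!has_pred1 !has_count Xck.
have Xl : X \in l by rewrite -has_pred1 has_count -Xck -has_count has_pred1.
rewrite (perm_trans (perm_to_rem Xk))// perm_sym (perm_trans (perm_to_rem Xl))//.
rewrite perm_cons perm_sym; apply: IH.
- by rewrite size_rem//; case: (k) Xk kn.
- by move=> Y; rewrite mem_cat => /orP[/mem_rem/ck|/mem_rem/cl].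
move=> p' q' ps' tq'; have := ckl _ _ ps' tq'.
by rewrite (permP (perm_to_rem Xk)) (permP (perm_to_rem Xl))/= => /addnI.
Qed.

End Multisets.

Lemma fiberwise_bijection (A B : eqType) (X : Type) (f : A -> X) (g : B -> X) :
  (forall x, exists (l : seq A) (m : seq B),
    [/\ uniq l, uniq m, size l = size m,
        forall a, a \in l <-> f a = x & forall b, b \in m <-> g b = x]) ->
  exists2 sigma : A -> B, bijective sigma & forall a, f a = g (sigma a).
Proof.
move=> fib.
have /choice[L /choice[K LK]] : forall x, exists (l : seq A), exists (m : seq B),
    [/\ uniq l, uniq m, size l = size m,
        forall a, a \in l <-> f a = x & forall b, b \in m <-> g b = x] by exact: fib.
have /choice[sigma sP] : forall a, exists b, g b = f a /\
    index b (K (f a)) = index a (L (f a)).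
  move=> a; have [ul um lm lP mP] := LK (f a).
  have al : a \in L (f a) by apply/lP.
  have ia : (index a (L (f a)) < size (K (f a)))%N by rewrite -lm index_mem.
  case E : (K (f a)) ia => [//|b0 m] ia; rewrite -E in ia *.
  exists (nth b0 (K (f a)) (index a (L (f a)))); split; last exact: index_uniq.
  by apply/mP; exact: mem_nth.
exists sigma => [|a]; last by rewrite (sP a).1.
apply: injective_onto_bijective => [a a' aa'|b].
  have [gs si] := sP a; have [gs' si'] := sP a'.
  have faa' : f a = f a' by rewrite -gs -gs' aa'.
  have [_ _ _ lP _] := LK (f a).
  rewrite -(nth_index a (_ : a \in L (f a))); last exact/lP.
  rewrite -[RHS](nth_index a (_ : a' \in L (f a))); last exact/lP.
  by rewrite -si aa' faa' si'.
have [ul um lm lP mP] := LK (g b).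
have bm : b \in K (g b) by apply/mP.
have ib : (index b (K (g b)) < size (L (g b)))%N by rewrite lm index_mem.
case E : (L (g b)) ib => [//|a0 l] ib; rewrite -E in ib *.
pose a := nth a0 (L (g b)) (index b (K (g b))).
have fa : f a = g b by apply/lP; exact: mem_nth.
exists a; have [gs si] := sP a; rewrite fa in gs si.
rewrite -(nth_index b (_ : sigma a \in K (g b))); last exact/mP.
by rewrite si index_uniq// nth_index.
Qed.

(** * Uniqueness of the decomposition *)

Section Uniqueness.
Context (F : fieldType) (d : Order.disp_t) (T : orderType d).

Lemma lmod_proj_linear (A : Type) (V : A -> lmodType F) (a : A) :
  linear (fun v : lmod_prod V => v a).
Proof. by []. Qed.

Definition lmod_proj (A : Type) (V : A -> lmodType F) (a : A) :
  {linear lmod_prod V -> V a} := linear_of (@lmod_proj_linear A V a).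

Definition cell_one (b : bool) : cell F b :=
  match b return cell F b with true => 1 : F | false => 0 end.

Lemma cell_valueK (b : bool) (x : cell F b) : cell_value F b x *: cell_one b = x.
Proof.
case: b x => x /=; first by rewrite /GRing.scale/= mulr1.
by apply/rowP => -[].
Qed.

Lemma cell_map_value (b c : bool) (x : cell F b) :
  b -> c -> cell_value F c (cell_map F b c x) = cell_value F b x.
Proof. by case: b x; case: c. Qed.

Lemma cell_map0 (b c : bool) (x : cell F b) : ~~ (b && c) -> cell_map F b c x = 0.
Proof. by case: b x; case: c => //= x _; apply/rowP => -[]. Qed.

Section Product.
Context (A : Type) (I : A -> order_interval T).
Local Notation N := (persmod_prod (fun a => interval_module F (I a))).
Local Notation A' := {classic A}.

Definition cell_unit (a : A') (t : T) : N t :=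
  fun b => if (b : A') == a then cell_one _ else 0.

Lemma interval_map_value b p q (pq : (p <= q)%O) (y : N p) :
  interval_set (I b) p -> interval_set (I b) q ->
  cell_value F (q \in (I b : set T)) (pm_map N pq y b) =
  cell_value F (p \in (I b : set T)) (y b).
Proof. by move=> bp bq; apply: cell_map_value; rewrite inE. Qed.

Lemma interval_map0 b p q (pq : (p <= q)%O) (y : N p) :
  ~ (interval_set (I b) p /\ interval_set (I b) q) -> pm_map N pq y b = 0.
Proof.
move=> nb; apply: cell_map0; apply/negP => /andP[]; rewrite !inE => bp bq.
exact: nb.
Qed.

Context (M : persmod F T) (f : persmod_hom M N) (g : persmod_hom N M).
Hypothesis fgK : forall t, cancel (f t) (g t) /\ cancel (g t) (f t).

Lemma iso_tmap p q (pq : (p <= q)%O) (y : N p) :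
  f q (tmap M p q (g p y)) = pm_map N pq y.
Proof. by rewrite (tmapE M pq) pm_hom_nat (fgK p).2. Qed.

Lemma rank_ge_intervals p q (l : seq A') : (p <= q)%O -> uniq l ->
  (forall a, a \in l -> interval_set (I a) p /\ interval_set (I a) q) ->
  rank_ge (tmap M p q) (size l).
Proof.
move=> pq ul lpq.
apply: (@rank_ge_biorthogonal _ _ _ _ _ l (fun a => g p (cell_unit a p))
  (fun a : A' => cell_value F (q \in (I a : set T)) \o
    (lmod_proj (fun b => interval_module F (I b) q) a \o f q))) => //.
move=> a b /lpq[ap aq] bl.
suff : cell_value F (q \in (I a : set T)) (pm_map N pq (cell_unit b p) a)
    = (a == b)%:R by rewrite -(iso_tmap pq).
rewrite interval_map_value// /cell_unit; case: eqP => _; last by rewrite linear0.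
by have -> : p \in (I a : set T) by rewrite inE.
Qed.

Lemma rank_ge_intervals_bound p q (l : seq A') (k : nat) : (p <= q)%O -> uniq l ->
  (forall a, a \in l <-> interval_set (I a) p /\ interval_set (I a) q) ->
  rank_ge (tmap M p q) k -> (k <= size l)%N.
Proof.
move=> pq ul lpq; pose ll := in_tuple l.
apply: (@rank_ge_bound _ _ _ _ _ _ (fun i => g q (cell_unit (tnth ll i) q))) => x.
pose y : N q := pm_map N pq (f p x).
exists (fun i => cell_value F _ (y (tnth ll i))).
rewrite -[LHS](fgK q).1 (tmapE M pq) pm_hom_nat -/y.
under eq_bigr do rewrite -linearZ/=.
rewrite -linear_sum/=; congr (g q _).
apply: functional_extensionality_dep => b.
rewrite -[RHS]/(lmod_proj (fun b => interval_module F (I b) q) b _) linear_sum/=.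
rewrite -(big_tnth _ _ _ xpredT (fun a : A' => as_linear
  (@lmod_proj_linear A (fun b => interval_module F (I b) q) b)
  (cell_value F _ (y a) *: cell_unit a q))).
have vE a : as_linear (@lmod_proj_linear A (fun b => interval_module F (I b) q) b)
    (cell_value F _ (y a) *: cell_unit a q) =
    cell_value F _ (y a) *: (if (b : A') == a then cell_one _ else 0) by [].
under eq_bigr do rewrite vE.
have [bl|nbl] := boolP ((b : A') \in l).
  rewrite (bigD1_seq (b : A'))//= eqxx cell_valueK big1 ?addr0// => a ab.
  by rewrite eq_sym (negbTE ab) scaler0.
rewrite big1_seq; last first.
  move=> a /= al; case: eqP => [ba|]; last by rewrite scaler0.
  by case/negP: nbl; rewrite ba.
by apply: interval_map0 => /lpq; exact/negP.
Qed.

(** At a maximum of an interval the corresponding unit vector would be nonzero but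
    die immediately, against upper semi-continuity. *)
Lemma interval_open : upper_semicontinuous M -> forall a t, interval_set (I a) t ->
  exists2 u, (t < u)%O & interval_set (I a) u.
Proof.
move=> uM a t at_; have tt : t \in (I a : set T) by rewrite inE.
have [|u tu xu] := usc_separated uM (x := g t (cell_unit a t)).
  move=> x0; have : f t (g t (cell_unit a t)) a = 0 by rewrite x0 linear0.
  rewrite (fgK t).2 /cell_unit eqxx => /(congr1 (cell_value F _)).
  by rewrite linear0 tt => /eqP; rewrite oner_eq0.
exists u => //; apply: contrapT => nau; apply: xu.
apply: (can_inj (fgK u).1); rewrite linear0 (iso_tmap (ltW tu)).
apply: functional_extensionality_dep => b.
have [ba|nba] := eqVneq (b : A') a; first by apply: interval_map0; rewrite ba => -[].
rewrite /= /prod_map /cell_unit (negbTE nba); exact: linear0.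
Qed.

End Product.

(** The rank of [M p -> M q] is the number of intervals containing [p] and [q],
    for either family. As no interval has a maximum, each contains some [s < t],
    and the finitely many intervals of each family through [s] and [t] form the
    same multiset. *)
Lemma interval_families_bijection (M : persmod F T)
    (A B : Type) (I : A -> order_interval T) (J : B -> order_interval T) :
  q_tame M -> upper_semicontinuous M ->
  persmod_iso M (persmod_prod (fun a => interval_module F (I a))) ->
  persmod_iso M (persmod_prod (fun b => interval_module F (J b))) ->
  exists2 sigma : A -> B,
    bijective sigma & forall a : A, I a = J (sigma a) :> set T.
Proof.
move=> qM uM [f [g fgK]] [f' [g' fgK']].
apply: (@fiberwise_bijection {classic A} {classic B} (set T)
  (fun a => I a : set T) (fun b => J b : set T)) => X.
(* A set X that is not an interval with two points is a member of neither
   family, so both fibers over it are empty. *)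
have [[s [t [st Xs Xt cX]]]|noX] := pselect (exists s t, [/\ (s < t)%O, X s, X t
    & forall p u q, X p -> X q -> (p <= u <= q)%O -> X u]); last first.
  have no C (K : C -> order_interval T) :
      (forall c t, interval_set (K c) t ->
        exists2 u, (t < u)%O & interval_set (K c) u) ->
      forall c, K c <> X :> set T.
    move=> Kopen c KX; apply: noX; have [s Ks] := interval_nonempty (K c).
    have [t st Kt] := Kopen _ _ Ks; exists s, t; rewrite -KX; split=> //.
    exact: interval_convex.
  exists [::], [::]; split=> //.
    by move=> a; split=> // aX; case: (no _ _ (interval_open fgK uM) a aX).
  by move=> b; split=> // bX; case: (no _ _ (interval_open fgK' uM) b bX).
have enumA p q : (p < q)%O -> exists2 l : seq {classic A}, uniq l &
    forall a, a \in l <-> interval_set (I a) p /\ interval_set (I a) q.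
  move=> pq; have [n nP] := q_tame_rank_bound qM pq.
  apply: (@bounded_enumeration {classic A}
    [set a | interval_set (I a) p /\ interval_set (I a) q] n) => l ul lS.
  by apply: nP; apply: rank_ge_intervals fgK _ _ _ (ltW pq) ul lS.
have enumB p q : (p < q)%O -> exists2 l : seq {classic B}, uniq l &
    forall b, b \in l <-> interval_set (J b) p /\ interval_set (J b) q.
  move=> pq; have [n nP] := q_tame_rank_bound qM pq.
  apply: (@bounded_enumeration {classic B}
    [set b | interval_set (J b) p /\ interval_set (J b) q] n) => l ul lS.
  by apply: nP; apply: rank_ge_intervals fgK' _ _ _ (ltW pq) ul lS.
have [l ul lP] := enumA _ _ st; have [m um mP] := enumB _ _ st.
have filt (C : eqType) (K : C -> order_interval T) (e : seq C) p q :
    (p <= s)%O -> (t <= q)%O ->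
    (forall c, c \in e <-> interval_set (K c) s /\ interval_set (K c) t) ->
    forall c, c \in [seq c <- e | through p q (K c)] <->
      interval_set (K c) p /\ interval_set (K c) q.
  move=> ps tq eP c; rewrite mem_filter; split=> [/andP[/asboolP//]|[cp cq]].
  apply/andP; split; first exact/asboolP.
  apply/eP; split; apply: (interval_convex cp cq).
    by rewrite ps (le_trans (ltW st) tq).
  by rewrite tq (le_trans ps (ltW st)).
have plm : perm_eq [seq (I a : set T) | a : {classic A} <- l]
    [seq (J b : set T) | b : {classic B} <- m].
  apply: (perm_eq_through (ltW st)).
    move=> Y; rewrite mem_cat => /orP[/mapP[a /lP[as_ at_] ->]|/mapP[b /mP[bs bt] ->]].
      by split=> //; exact: interval_convex.
    by split=> //; exact: interval_convex.
  move=> p q ps tq; rewrite !count_map -!size_filter.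
  have pq : (p <= q)%O := le_trans ps (le_trans (ltW st) tq).
  apply/eqP; rewrite eqn_leq; apply/andP; split.
    apply: (rank_ge_intervals_bound fgK' pq); [exact: filter_uniq|exact: filt|].
    apply: (rank_ge_intervals fgK pq); first exact: filter_uniq.
    by move=> a; exact: (filt _ _ _ _ _ ps tq lP a).1.
  apply: (rank_ge_intervals_bound fgK pq); [exact: filter_uniq|exact: filt|].
  apply: (rank_ge_intervals fgK' pq); first exact: filter_uniq.
  by move=> b; exact: (filt _ _ _ _ _ ps tq mP b).1.
exists [seq a : {classic A} <- l | (I a : set T) == X],
  [seq b : {classic B} <- m | (J b : set T) == X]; split.
- exact: filter_uniq.
- exact: filter_uniq.
- by have /permP/(_ (pred1 X)) := plm; rewrite !count_map -!size_filter.
- move=> a; rewrite mem_filter; split=> [/andP[/eqP]//|aX].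
  by rewrite aX eqxx; apply/lP; rewrite aX.
- move=> b; rewrite mem_filter; split=> [/andP[/eqP]//|bX].
  by rewrite bX eqxx; apply/mP; rewrite bX.
Qed.

End Uniqueness.

Theorem theorem1p3 (F : fieldType) (d : Order.disp_t) (T : orderType d)
    (T_dense : order_dense T)
    (T_coinitial : forall I : order_interval T,
      exists2 N : set T, countable N & coinitial N I)
    (M : persmod F T) (M_qtame : q_tame M) (M_usc : upper_semicontinuous M) :
  exists (A : Type) (I : A -> order_interval T),
    persmod_iso M (persmod_prod (fun a => interval_module F (I a))) /\
    forall (B : Type) (J : B -> order_interval T),
      persmod_iso M (persmod_prod (fun b => interval_module F (J b))) ->
      exists2 sigma : A -> B,
        bijective sigma & forall a : A, I a = J (sigma a) :> set T.
Proof.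
have [A [I MI]] := usc_q_tame_decomposition M_qtame M_usc.
exists A, I; split=> // B J MJ.
exact: interval_families_bijection M_qtame M_usc MI MJ.
Qed.
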